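(* There is a universal constant $c>0$ such that for all integers $m\ge 2$ and $n\ge 1$ the following holds. Let $\mathcal{A}$ be a deterministic clock synchronization algorithm that is correct on every connected graph with $m$ vertices with uncertainty parameter $n$. Then there exist a connected $m$-vertex graph (with processors assigned to its vertices) and wake-up times in $\{0,1,\dots,n\}$ such that, in the resulting execution of $\mathcal{A}$, the sum over all processors of their radio use is at least $c\, m\sqrt{n}$. Consequently the energy efficiency of $\mathcal{A}$ is $\Omega(\sqrt{n})$ both when it is defined as the worst-case maximum radio use of a processor and when it is defined as the worst-case average radio use over the processors.
   Context: Model. A network is an undirected graph $G=(V,E)$ with $m$ vertices, the processors, which carry distinct identities $1,\dots,m$. Global time is divided into discrete time units $0,1,2,\dots$ and is not available to the processors. Processor $i$ wakes up at the beginning of global time unit $t_i\in\{0,1,\dots,n\}$. The $t_i$ are chosen arbitrarily and are unknown to the processors; the uncertainty parameter $n$ (and $m$) are known to all processors, but the graph $G$ is not. In each time unit after wake-up a processor's radio is either on or off (before wake-up it is off). If in a global time unit the radios of two adjacent processors are both on, each receives the message sent by the other in that time unit; a processor receives the messages of all its neighbours whose radios are on (there is no interference). Processors that are not adjacent cannot communicate directly. If its radio is off, a processor neither sends nor receives. A deterministic algorithm decides for each processor, as a deterministic function of $n$, $m$, the identity of the processor, the number of time units since its own wake-up, and all messages received in earlier time units, whether the radio is on in the current time unit; the content of messages is likewise determined by the information available to the processor. A clock synchronization algorithm is correct on $G$ if for all wake-up times $t_1,\dots,t_m\in\{0,1,\dots,n\}$ its execution contains a global time unit in which the radios of all $m$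 processors are simultaneously on (and the processors synchronize their clocks in it). The radio use of a processor in an execution is the number of time units during which its radio is on. The energy efficiency of an algorithm is considered in two scenarios: (first) the maximum radio use of a processor, in the worst case; (second) the average over the processors of their radio use, in the worst case. *)

(* Defs.v *)
From HB Require Import structures.
From mathcomp Require Import all_boot all_order all_algebra.
From mathcomp Require Import all_classical all_reals all_analysis.

Set Implicit Arguments.
Unset Strict Implicit.
Unset Printing Implicit Defensive.

Import Order.TTheory GRing.Theory Num.Theory.
Local Open Scope ring_scope.

(* Processors are identified with their identities, so the networks on all
   [graph m] range over all m-vertex graphs together with all assignments of
   identities; i : 'I_m stands for identity i + 1. *)
Record graph (m : nat) := Graph {
  edge : rel 'I_m;
  edge_sym : symmetric edge;
  edge_irrefl : irreflexive edge }.

Definition graph_connected (m : nat) (G : graph m) : Prop :=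
  forall i j : 'I_m, connect (edge G) i j.

(* What a processor receives in one time unit: the message of each sender it
   hears, None for the processors it does not hear. *)
Definition inbox (M : Type) (m : nat) := {ffun 'I_m -> option M}.

(* The arguments are n, m, the identity, the number s of time units since
   wake-up, and the s inboxes of those units, oldest first. *)
Record algorithm := Algorithm {
  message : Type;
  radio : forall (n m : nat), 'I_m -> nat -> seq (inbox message m) -> bool;
  content : forall (n m : nat), 'I_m -> nat -> seq (inbox message m) -> message }.

Arguments radio A n {m} i s hist : rename.
Arguments content A n {m} i s hist : rename.

Section Execution.
Variables (A : algorithm) (n m : nat) (G : graph m) (wake : 'I_m -> 'I_n.+1).

(* In the next three definitions, h i is the history of processor i at the
   beginning of global time unit t. *)
Definition on_with (h : 'I_m -> seq (inbox (message A) m)) (t : nat) (i : 'I_m)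
    : bool :=
  (wake i <= t)%N && radio A n i (t - wake i)%N (h i).

Definition sent_with (h : 'I_m -> seq (inbox (message A) m)) (t : nat)
    (i : 'I_m) : message A :=
  content A n i (t - wake i)%N (h i).

Definition inbox_with (h : 'I_m -> seq (inbox (message A) m)) (t : nat)
    (i : 'I_m) : inbox (message A) m :=
  [ffun j => if [&& edge G i j, on_with h t i & on_with h t j]
             then Some (sent_with h t j) else None].

Fixpoint history (t : nat) : 'I_m -> seq (inbox (message A) m) :=
  if t is t'.+1 then
    fun i => if (wake i <= t')%N
             then rcons (history t' i) (inbox_with (history t') t' i)
             else [::]
  else fun=> [::].

Definition radio_on (t : nat) (i : 'I_m) : bool := on_with (history t) t i.

(* Extended-real valued, as a radio may be on infinitely often. *)
Definition radio_use (R : realType) (i : 'I_m) : \bar R :=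
  (\sum_(0 <= t <oo) ((radio_on t i)%:R)%:E)%E.

Definition total_radio_use (R : realType) : \bar R :=
  (\sum_(i < m) radio_use R i)%E.

Definition max_radio_use (R : realType) : \bar R :=
  \big[maxe/0%E]_(i < m) radio_use R i.

Definition average_radio_use (R : realType) : \bar R :=
  ((m%:R^-1)%:E * total_radio_use R)%E.

End Execution.

Definition correct_on (A : algorithm) (n m : nat) (G : graph m) : Prop :=
  forall wake : 'I_m -> 'I_n.+1,
    exists t : nat, forall i : 'I_m, radio_on A G wake t i.

Definition energy_max (R : realType) (A : algorithm) (n m : nat) : \bar R :=
  ereal_sup [set x | exists (G : graph m) (wake : 'I_m -> 'I_n.+1),
    graph_connected G /\ x = max_radio_use A G wake R].

Definition energy_average (R : realType) (A : algorithm) (n m : nat) : \bar R :=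
  ereal_sup [set x | exists (G : graph m) (wake : 'I_m -> 'I_n.+1),
    graph_connected G /\ x = average_radio_use A G wake R].

(* Main.v *)
(* Take a comb: a clique on the vertices i >= h := m./2, with a pendant vertex
   i < h (a tooth) attached to i + h, and draw all wake-up times independently
   and uniformly.  Until a tooth l first meets its neighbour v, the execution is
   the one on the graph without l: l follows its silent schedule, shifted by its
   wake-up time, and v does not depend on that wake-up time.  If l and v both
   used their radio at most k times before meeting, their numbers of uses
   determine the wake-up time of l, so that at most (k + 1)^2 of its n + 1 values
   lead to such an early meeting.  With 2 (k + 1)^2 <= n + 1, each pair (l, v)
   hence pays more than k + 1 with probability at least 1/2, and for some choice
   of the wake-up times at least half of the pairs do. *)
Require Import Defs.
From HB Require Import structures.
From mathcomp Require Import all_boot all_order all_algebra.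
From mathcomp Require Import all_classical all_reals all_analysis.
From mathcomp Require Import zify lra.

Set Implicit Arguments.
Unset Strict Implicit.
Unset Printing Implicit Defensive.

Import Order.TTheory GRing.Theory Num.Theory.
Local Open Scope ring_scope.

(** * Isolated processors and executions without a given vertex *)

Definition delete_vertex_rel (m : nat) (G : graph m) (l : 'I_m) : rel 'I_m :=
  fun i j => [&& edge G i j, i != l & j != l].

Lemma delete_vertex_sym m (G : graph m) l : symmetric (delete_vertex_rel G l).
Proof. by move=> i j; rewrite /delete_vertex_rel edge_sym [(i != l) && _]andbC. Qed.

Lemma delete_vertex_irrefl m (G : graph m) l : irreflexive (delete_vertex_rel G l).
Proof. by move=> i; rewrite /delete_vertex_rel edge_irrefl. Qed.

(** The vertex [l] stays, isolated, so that both graphs have the same processors and [l] still runs,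
    hearing nobody. *)
Definition delete_vertex m (G : graph m) l : graph m :=
  Graph (delete_vertex_sym G l) (@delete_vertex_irrefl m G l).

Section Locality.
Variables (A : algorithm) (n m : nat).
Implicit Types (G : graph m) (wake : 'I_m -> 'I_n.+1) (i l v : 'I_m).

Lemma history_isolated G wake i : (forall j, ~~ edge G i j) ->
  forall t, history A G wake t i = nseq (t - wake i) [ffun=> None].
Proof.
move=> iso; elim=> [//|t IH] /=.
case: leqP => [le_it|lt_ti]; last first.
  by have -> : (t.+1 - wake i = 0)%N by apply/eqP; rewrite subn_eq0.
rewrite IH subSn // -[in RHS]addn1 nseqD cats1; congr rcons.
by apply/ffunP => j; rewrite !ffunE (negbTE (iso j)).
Qed.

Lemma radio_on_isolated G wake i : (forall j, ~~ edge G i j) ->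
  forall t, radio_on A G wake t i =
    (wake i <= t)%N && radio A n i (t - wake i) (nseq (t - wake i) [ffun=> None]).
Proof. by move=> iso t; rewrite /radio_on /on_with history_isolated. Qed.

(** An isolated [l] sends nothing to anyone, so its wake-up time cannot influence the other
    processors. *)
Lemma history_ext G wake wake' l : (forall j, ~~ edge G l j) ->
  (forall i, i != l -> wake i = wake' i) ->
  forall t i, i != l -> history A G wake t i = history A G wake' t i.
Proof.
move=> iso eqw; elim=> [//|t IH] i il /=.
rewrite -eqw // IH //; case: ifP => // _; congr rcons.
apply/ffunP => j; rewrite !ffunE.
have [->|jl] := eqVneq j l; first by rewrite edge_sym (negbTE (iso i)).
by rewrite /on_with /sent_with !IH // -!eqw.
Qed.

Lemma radio_on_ext G wake wake' l : (forall j, ~~ edge G l j) ->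
  (forall i, i != l -> wake i = wake' i) ->
  forall t i, i != l -> radio_on A G wake t i = radio_on A G wake' t i.
Proof.
move=> iso eqw t i il.
by rewrite /radio_on /on_with (history_ext iso eqw) // eqw.
Qed.

Lemma delete_vertex_isolated G l j : ~~ edge (delete_vertex G l) l j.
Proof. by rewrite /= /delete_vertex_rel eqxx andbF. Qed.

(** Deletion can only lose the edge between [l] and [v], and this edge carries messages only when
    both radios are on. By induction on time the two executions agree as long as this has not
    happened in the graph without [l]. *)
Lemma history_before_meeting G wake l v : (forall j, edge G l j -> j = v) ->
  forall t,
  (forall s, (s < t)%N -> ~~ (radio_on A (delete_vertex G l) wake s l &&
                              radio_on A (delete_vertex G l) wake s v)) ->
  history A G wake t = history A (delete_vertex G l) wake t.
Proof.
move=> leaf; elim=> [//|t IH] nomeet.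
have {}IH := IH (fun s lt_st => nomeet s (leqW lt_st)).
have {}nomeet := nomeet t (ltnSn t).
apply/funext => i /=; rewrite IH; case: ifP => // _; congr rcons.
apply/ffunP => j; rewrite !ffunE /= /delete_vertex_rel.
have [Gij|//] := boolP (edge G i j).
have [ij_l|] := boolP ((i == l) || (j == l)); last first.
  by rewrite negb_or => ->.
suff /negbTE-> : ~~ (on_with wake (history A (delete_vertex G l) wake t) t i &&
                     on_with wake (history A (delete_vertex G l) wake t) t j).
  by case: ifP => // /andP[_].
by case/orP: ij_l Gij => /eqP ->; last rewrite edge_sym andbC; move=> /leaf ->.
Qed.

End Locality.

(** * Counting the early meetings of a leaf with its neighbour *)

(** The count increases strictly when it passes a time at which [p] holds, so such a time is
    determined by the number of earlier ones. *)
Lemma count_upto_inj (p : pred nat) s t : p s -> p t ->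
  (\sum_(0 <= r < s) p r = \sum_(0 <= r < t) p r)%N -> s = t.
Proof.
have lt_count a b : p a -> (a < b)%N ->
    (\sum_(0 <= r < a) p r < \sum_(0 <= r < b) p r)%N.
  move=> pa lt_ab; rewrite (big_cat_nat _ lt_ab) //= big_nat_recr //= pa.
  by rewrite addn1 leq_addr.
move=> ps pt eq_st.
case: (ltngtP s t) => // [/(lt_count _ _ ps)|/(lt_count _ _ pt)];
by rewrite eq_st ltnn.
Qed.

Lemma count_upto_shift (p : pred nat) d t :
  (\sum_(0 <= s < t) ((d <= s) && p (s - d)) = \sum_(0 <= s < t - d) p s)%N.
Proof.
elim: t => [|t IH]; first by rewrite sub0n !big_geq.
rewrite big_nat_recr //= IH; case: leqP => [le_dt|lt_td] /=.
  by rewrite subSn // big_nat_recr.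
by rewrite addn0 !big_geq // leqn0 subn_eq0 // ltnW.
Qed.

Section Leaf.
Variables (A : algorithm) (n m : nat) (G : graph m) (l v : 'I_m).
Hypotheses (leaf : forall j, edge G l j -> j = v) (vNl : v != l).

Definition use_before (H : graph m) (wake : 'I_m -> 'I_n.+1) (t : nat)
    (i : 'I_m) : nat :=
  (\sum_(0 <= s < t) radio_on A H wake s i)%N.

Definition meeting (H : graph m) (wake : 'I_m -> 'I_n.+1) (t : nat) : bool :=
  radio_on A H wake t l && radio_on A H wake t v.

(** The time is that of the first meeting in the graph without [l]. Unit [t] itself is included,
    since the radios at [t] depend only on what was received earlier. *)
Lemma first_meeting (wake : 'I_m -> 'I_n.+1) : correct_on A n G ->
  exists2 t, meeting (delete_vertex G l) wake t &
    forall s i, (s <= t)%N ->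
      radio_on A G wake s i = radio_on A (delete_vertex G l) wake s i.
Proof.
move=> /(_ wake)[t0 on_t0].
have [t Mt min_t] : exists2 t, meeting (delete_vertex G l) wake t &
    forall s, meeting (delete_vertex G l) wake s -> (t <= s)%N.
  have [ex|noex] := pselect (exists t, meeting (delete_vertex G l) wake t).
    by case: (ex_minnP ex) => t; exists t.
  (* Without any meeting both executions coincide forever, so the unit given by correctness would be
     a meeting. *)
  exfalso; apply: (noex); exists t0; rewrite /meeting /radio_on.
  rewrite -(history_before_meeting leaf) => [|s _]; last first.
    by apply/negP => Ms; apply: noex; exists s.
  by rewrite -!/(radio_on A G wake t0 _) !on_t0.
exists t => // s i le_st.
rewrite /radio_on (history_before_meeting leaf) // => r lt_rs.
by apply/negP => /min_t; rewrite leqNgt (leq_trans lt_rs).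
Qed.

(* A pair (w, d), with w an early meeting, is encoded by the numbers of uses of l
   and v before the meeting and by w updated to d at l; w l can be recovered
   since, without l, the uses of v do not depend on it. *)
Lemma card_early_meeting k (tau : {ffun 'I_m -> 'I_n.+1} -> nat) :
  (forall w : {ffun _}, meeting (delete_vertex G l) w (tau w)) ->
  (#|[set w : {ffun 'I_m -> 'I_n.+1} |
      (use_before (delete_vertex G l) w (tau w) l <= k) &&
      (use_before (delete_vertex G l) w (tau w) v <= k)]| * n.+1
   <= k.+1 * k.+1 * #|{ffun 'I_m -> 'I_n.+1}|)%N.
Proof.
move=> Mtau; set B := [set w | _].
pose upd (w : {ffun 'I_m -> 'I_n.+1}) d : {ffun 'I_m -> 'I_n.+1} :=
  [ffun i => if i == l then d else w i].
pose code (x : {ffun 'I_m -> 'I_n.+1} * 'I_n.+1) :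
    'I_k.+1 * 'I_k.+1 * {ffun 'I_m -> 'I_n.+1} :=
  (* On [B] both counts are at most [k], so [inord] loses nothing there. *)
  (inord (use_before (delete_vertex G l) x.1 (tau x.1) l),
   inord (use_before (delete_vertex G l) x.1 (tau x.1) v), upd x.1 x.2).
have <- : #|finset.setX B [set: 'I_n.+1]| = (#|B| * n.+1)%N.
  by rewrite cardsX cardsT card_ord.
have -> : (k.+1 * k.+1 * #|{ffun 'I_m -> 'I_n.+1}|)%N =
    #|{: 'I_k.+1 * 'I_k.+1 * {ffun 'I_m -> 'I_n.+1}}|.
  by rewrite !card_prod !card_ord.
apply: (leq_card_in code) => -[w d] [w' d'].
rewrite !inE /= !andbT => /andP[wl wv] /andP[wl' wv'] [eq_l eq_v /ffunP eq_upd].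
have eqd : d = d' by have := eq_upd l; rewrite !ffunE eqxx.
have eqw i : i != l -> w i = w' i.
  by move=> il; have := eq_upd i; rewrite !ffunE (negbTE il).
have iso := @delete_vertex_isolated m G l.
have /andP[onl onv] := Mtau w; have /andP[onl' onv'] := Mtau w'.
(* The schedule of [v] is the same under [w] and [w'], so its number of uses determines the global
   time of the meeting. *)
have eq_tau : tau w = tau w'.
  have eq_on s := @radio_on_ext A n m _ w w' l iso eqw s v vNl.
  move/(congr1 (@nat_of_ord _)): eq_v; rewrite !inordK // /use_before => eq_v.
  apply: (@count_upto_inj (fun s => radio_on A (delete_vertex G l) w s v)) => //.
    by rewrite eq_on.
  by rewrite eq_v; apply: eq_bigr => s _; rewrite eq_on.
(* The silent schedule of [l], in its local time. *)
pose S s := radio A n l s (nseq s [ffun=> None]).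
have onE (u : {ffun 'I_m -> 'I_n.+1}) s :
    radio_on A (delete_vertex G l) u s l = (u l <= s)%N && S (s - u l)%N.
  exact: radio_on_isolated.
move: onl onl'; rewrite !onE => /andP[le_wl Sw] /andP[le_wl' Sw'].
have useE (u : {ffun 'I_m -> 'I_n.+1}) : use_before (delete_vertex G l) u (tau u) l =
    (\sum_(0 <= s < tau u - u l) S s)%N.
  by rewrite -count_upto_shift; apply: eq_bigr => s _; rewrite onE.
(* The number of uses of [l] determines its local time at the meeting; the difference from the
   global time is its wake-up time. *)
have eq_local : (tau w - w l = tau w' - w' l)%N.
  apply: count_upto_inj Sw Sw' _.
  by move/(congr1 (@nat_of_ord _)): eq_l; rewrite !inordK // !useE.
have eq_wl : w l = w' l.
  by apply/val_inj; rewrite /= -(subKn le_wl) eq_local eq_tau subKn.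
rewrite eqd; congr pair; apply/ffunP => i.
by have [->|/eqw] := eqVneq i l.
Qed.

(** Stated with a finite prefix, since the full radio use may be infinite. *)
Definition pair_pays (k : nat) (wake : 'I_m -> 'I_n.+1) : bool :=
  `[< exists t, (k < use_before G wake t l + use_before G wake t v)%N >].

Lemma card_pair_pays k : correct_on A n G -> (2 * k.+1 ^ 2 <= n.+1)%N ->
  (#|{ffun 'I_m -> 'I_n.+1}| <=
     2 * #|[set w : {ffun 'I_m -> 'I_n.+1} | pair_pays k.+1 w]|)%N.
Proof.
move=> corr le_kn.
have /choice[tau tauP] : forall w : {ffun 'I_m -> 'I_n.+1}, exists t,
    meeting (delete_vertex G l) w t /\
    forall s i, (s <= t)%N ->
      radio_on A G w s i = radio_on A (delete_vertex G l) w s i.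
  by move=> w; have [t] := first_meeting w corr; exists t.
have := card_early_meeting k (fun w : {ffun _} => (tauP w).1).
set B := [set w | _]; set P := [set w | _] => le_B.
have sub_P : ~: P \subset B.
  apply/fintype.subsetP => w; rewrite !inE; apply: contraR => early.
  apply/asboolP; exists (tau w).+1.
  have [/andP[onl onv] eq_on] := tauP w.
  have useS i : radio_on A (delete_vertex G l) w (tau w) i ->
      use_before G w (tau w).+1 i = (use_before (delete_vertex G l) w (tau w) i).+1.
    move=> on_i; rewrite /use_before big_nat_recr //= eq_on // on_i addn1.
    congr _.+1; apply: eq_big_nat => s /andP[_ lt_s].
    by rewrite eq_on // ltnW.
  (* Before the meeting one of the two has used its radio more than [k] times, and the meeting adds
     a use for each. *)
  move: early; rewrite !useS // negb_and -!ltnNge addSn addnS 2!ltnS.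
  by case/orP => /ltnW/leq_trans -> //; rewrite ?leq_addr ?leq_addl.
have le_2B : (2 * #|B| <= #|{ffun 'I_m -> 'I_n.+1}|)%N.
  rewrite -(leq_pmul2r (ltn0Sn n)) -mulnA.
  apply: leq_trans (leq_mul (leqnn 2) le_B) _.
  by rewrite mulnA mulnC leq_mul2l mulnn le_kn orbT.
move: le_2B (subset_leq_card sub_P) (cardsC P).
move: #|B| #|P| #|~: P| #|{: {ffun 'I_m -> 'I_n.+1}}| => b p q u; lia.
Qed.

End Leaf.

(** * Averaging over the wake-up times *)

(** Double counting of the pairs [(w, j)] with [P j w]: if every [w] satisfied less than half of
    [L], the total would be too small. A nonempty [W] makes the inequality of the sums strict. *)
Lemma exists_half_satisfied (W J : finType) (L : {set J}) (P : J -> pred W) :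
  (0 < #|W|)%N ->
  (forall j, j \in L -> (#|W| <= 2 * #|[set w | P j w]|)%N) ->
  exists w, (#|L| <= 2 * #|[set j in L | P j w]|)%N.
Proof.
move=> W0 half; apply/not_existsP => few.
have : (\sum_(w : W) \sum_(j in L) 2 * P j w < \sum_(w : W) #|L|)%N.
  have [w0 _] : exists w0 : W, w0 \in W by apply/card_gt0P.
  have lt_L w : (\sum_(j in L) 2 * P j w < #|L|)%N.
    move/negP: (few w); rewrite -ltnNge; congr (_ < _)%N.
    rewrite -big_distrr /= -sum1_card; congr (2 * _)%N.
    rewrite [LHS](eq_bigl (fun j => (j \in L) && P j w)) => [|j]; last first.
      by rewrite inE.
    by rewrite [LHS]big_mkcondr; apply: eq_bigr => j _; case: (P j w).
  rewrite (bigD1 w0) //= [ltnRHS](bigD1 w0) //= -addSn leq_add //.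
  by apply: leq_sum => w _; exact: ltnW.
rewrite exchange_big /= ltnNge sum_nat_const => /negP; apply.
rewrite mulnC -sum_nat_const; apply: leq_sum => j /half le_W.
rewrite -big_distrr /=; suff <- : #|[set w | P j w]| = (\sum_w P j w)%N by [].
rewrite -sum1_card (eq_bigl (P j)) => [|w]; last by rewrite inE.
by rewrite big_mkcond; apply: eq_bigr => w _; case: (P j w).
Qed.

(** * The comb graph *)

(** For odd [m] the last clique vertex carries no tooth. *)
Definition comb_rel (m : nat) : rel 'I_m := fun i j =>
  (i != j) && [|| (m./2 <= i)%N && (m./2 <= j)%N,
                  (i < m./2)%N && (j == (i + m./2)%N :> nat) |
                  (j < m./2)%N && (i == (j + m./2)%N :> nat)].

Lemma comb_sym m : symmetric (@comb_rel m).
Proof.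
move=> i j.
by rewrite /comb_rel eq_sym [(_ <= i)%N && _]andbC [X in _ || X]orbC.
Qed.

Lemma comb_irrefl m : irreflexive (@comb_rel m).
Proof. by move=> i; rewrite /comb_rel eqxx. Qed.

Definition comb (m : nat) : graph m := Graph (@comb_sym m) (@comb_irrefl m).

Lemma tooth_subproof m (i : 'I_m) : ((if i < m./2 then i + m./2 else i) < m)%N.
Proof. by case: ifP; have := ltn_ord i; lia. Qed.

(** On clique vertices the value is a mere default. *)
Definition tooth_base m (i : 'I_m) : 'I_m := Ordinal (tooth_subproof i).

Lemma tooth_baseE m (i : 'I_m) : (i < m./2)%N -> tooth_base i = (i + m./2)%N :> nat.
Proof. by rewrite /= => ->. Qed.

Lemma comb_tooth m (i : 'I_m) : (i < m./2)%N ->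
  forall j, edge (comb m) i j -> j = tooth_base i.
Proof.
move=> lt_i j; rewrite /= /comb_rel => /andP[_ adj].
by apply/val_inj; rewrite /= lt_i; move: adj lt_i; lia.
Qed.

Lemma comb_connected m : (2 <= m)%N -> graph_connected (comb m).
Proof.
move=> m2.
have lt_hub : (m./2 < m)%N by lia.
pose hub := Ordinal lt_hub.
have conn_spine (i : 'I_m) : (m./2 <= i)%N -> connect (edge (comb m)) i hub.
  move=> le_i; have [->|iN] := eqVneq i hub; first exact: connect0.
  by apply: connect1; rewrite /= /comb_rel iN le_i /= leqnn.
have conn_hub i : connect (edge (comb m)) i hub.
  have [/conn_spine //|lt_i] := leqP m./2 i.
  have base := tooth_baseE lt_i.
  apply: connect_trans (conn_spine (tooth_base i) _); last by rewrite base leq_addl.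
  apply: connect1; rewrite -[edge _ _ _]/(comb_rel _ _) /comb_rel.
  rewrite base lt_i eqxx orbT andbT.
  by apply/eqP => /(congr1 (@nat_of_ord m)); rewrite base; lia.
move=> i j; apply: connect_trans (conn_hub i) _.
by rewrite (sym_connect_sym (edge_sym (comb m))).
Qed.

(** * From pairs to total, maximum and average radio use *)

(** The pairs [(i, p i)] with [i] in [L] are pairwise disjoint, and the remaining terms are
    nonnegative. *)
Lemma sum_pairs_ge (R : realType) (I : finType) (f : I -> \bar R) (p : I -> I)
    (L : {set I}) (c : R) :
  (forall i, 0 <= f i)%E -> {in L &, injective p} ->
  {in L, forall i, p i \notin L} ->
  {in L, forall i, (c%:E <= f i + f (p i))%E} ->
  ((#|L|%:R * c)%:E <= \sum_i f i)%E.
Proof.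
move=> f0 p_inj pNL le_c.
have dis : [disjoint L & p @: L].
  rewrite disjoint_subset; apply/fintype.subsetP => i Li; rewrite inE.
  by apply/imsetP => -[j /pNL + eq_i]; rewrite -eq_i Li.
apply: (@le_trans _ _ (\sum_(i in L :|: p @: L) f i)%E); last first.
  by apply: lee_sum_nneg_subset => // i _; exact: f0.
rewrite (eq_bigl [predU L & p @: L]) => [|i]; last by rewrite !inE.
rewrite bigU //= big_imset //= -big_split /=.
apply: (@le_trans _ _ (\sum_(i in L) c%:E)%E); last exact: lee_sum.
by rewrite sumEFin sumr_const mulr_natl.
Qed.

Section RadioUse.
Variables (R : realType) (A : algorithm) (n m : nat) (G : graph m).
Variable wake : 'I_m -> 'I_n.+1.

Lemma radio_use_ge0 i : (0 <= radio_use A G wake R i)%E.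
Proof. by apply: nneseries_ge0 => t _ _; rewrite lee_fin. Qed.

Lemma use_before_le t i :
  ((use_before A G wake t i)%:R%:E <= radio_use A G wake R i)%E.
Proof.
apply: le_trans (nneseries_lim_ge t _); last by move=> s _ _; rewrite lee_fin.
by rewrite sumEFin lee_fin /use_before natr_sum.
Qed.

Lemma average_le_max : (0 < m)%N ->
  (average_radio_use A G wake R <= max_radio_use A G wake R)%E.
Proof.
move=> m0; rewrite /average_radio_use lee_pdivrMl ?ltr0n //.
set M := max_radio_use _ _ _ _.
have le_M i : (radio_use A G wake R i <= M)%E by exact: le_bigmax.
apply: (@le_trans _ _ (\sum_(i < m) M)%E); first exact: lee_sum.
by rewrite sumr_const card_ord mule_natl.
Qed.

End RadioUse.

(** * Choice of the threshold and the lower bound *)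

(** The largest [k] that the counting argument allows; its maximality makes [k] of order the square
    root of [n]. *)
Lemma half_square_floor n : (1 <= n)%N ->
  exists k, (2 * k.+1 ^ 2 <= n.+1 < 2 * k.+2 ^ 2)%N.
Proof.
move=> n1.
have ex : exists k, (2 * k.+1 ^ 2 <= n.+1)%N by exists 0%N.
have bnd k : (2 * k.+1 ^ 2 <= n.+1)%N -> (k <= n)%N by nia.
case: (ex_maxnP ex bnd) => k le_k max_k; exists k; rewrite le_k ltnNge.
by apply/negP => /max_k; rewrite ltnn.
Qed.

Theorem theorem4p3 (R : realType) :
  exists c : R, 0 < c /\
    forall m n : nat, (2 <= m)%N -> (1 <= n)%N ->
    forall A : algorithm,
      (forall G : graph m, graph_connected G -> correct_on A n G) ->
      (exists (G : graph m) (wake : 'I_m -> 'I_n.+1),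
          graph_connected G /\
          ((c * m%:R * Num.sqrt n%:R)%:E <= total_radio_use A G wake R)%E) /\
      ((c * Num.sqrt n%:R)%:E <= energy_max R A n m)%E /\
      ((c * Num.sqrt n%:R)%:E <= energy_average R A n m)%E.
Proof.
(* The 12 is 6 times 2: at least [m / 3] vertices are teeth and half of them pay, so
   [m <= 6 * #|P|], while the square root of [n] is at most [2 * (k + 2)]. *)
exists (12%:R^-1); split; first by rewrite invr_gt0 ltr0n.
move=> m n m2 n1 A corr.
have [k /andP[le_kn lt_nk]] := half_square_floor n1.
have conn := comb_connected m2.
pose teeth := [set i : 'I_m | (i < m./2)%N].
have tooth i : i \in teeth -> (i < m./2)%N by rewrite inE.
have base_ge i : i \in teeth -> (m./2 <= tooth_base i)%N.
  by move=> /tooth lt_i; rewrite tooth_baseE // leq_addl.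
have base_notin i : i \in teeth -> tooth_base i \notin teeth.
  by move=> /base_ge ge_i; rewrite inE -leqNgt.
have base_inj : {in teeth &, injective (@tooth_base m)}.
  move=> i j /tooth lt_i /tooth lt_j /(congr1 (@nat_of_ord m)).
  by rewrite !tooth_baseE // => /addIn/val_inj.
(* The factor 3 is attained at [m = 3], with a single tooth. *)
have card_teeth : (m <= 3 * #|teeth|)%N.
  have lt_hm : (m./2 <= m)%N by lia.
  have <- : m./2 = #|teeth|.
    rewrite -[LHS]card_ord -(card_imset predT (f := widen_ord lt_hm)); last first.
      by move=> i j /(congr1 val) /= /val_inj.
    apply: eq_card => i; rewrite inE; apply/imsetP/idP => [[j _ ->]|lt_i].
      exact: ltn_ord j.
    by exists (Ordinal lt_i) => //; exact/val_inj.
  lia.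
have [||w] := @exists_half_satisfied {ffun 'I_m -> 'I_n.+1} _ teeth
    (fun l w => pair_pays A (comb m) l (tooth_base l) k.+1 w).
- by rewrite card_ffun !card_ord expn_gt0.
- move=> l Ll; apply: card_pair_pays (corr _ conn) le_kn.
    exact/comb_tooth/tooth.
  by apply: contraNneq (base_notin _ Ll) => ->.
set P := [set l in teeth | _] => half_P.
have sub_P l : l \in P -> l \in teeth by rewrite inE => /andP[].
have total_ge : ((12%:R^-1 * m%:R * Num.sqrt n%:R)%:E <=
    total_radio_use A (comb m) w R)%E.
  apply: (@le_trans _ _ (#|P|%:R * k.+2%:R)%:E); last first.
    apply: (@sum_pairs_ge _ _ _ (@tooth_base m)).
    - exact: radio_use_ge0.
    - by move=> i j /sub_P Li /sub_P Lj; exact: base_inj.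
    - by move=> l /sub_P/base_notin; apply: contra => /sub_P.
    - move=> l; rewrite inE => /andP[_ /asboolP[t lt_k]].
      apply: le_trans (leeD (use_before_le R A (comb m) w t l)
        (use_before_le R A (comb m) w t (tooth_base l))).
      by rewrite -EFinD lee_fin -natrD ler_nat.
  have le_sqrt : Num.sqrt n%:R <= 2%:R * k.+2%:R :> R.
    rewrite -natrM -[leRHS]ger0_norm ?ler0n // -sqrtr_sqr ler_wsqrtr //.
    by rewrite -natrX ler_nat; move: lt_nk; rewrite -!mulnn; nia.
  have le_m : m%:R <= 6%:R * #|P|%:R :> R.
    by rewrite -natrM ler_nat; move: #|P| #|teeth| half_P card_teeth => p q; lia.
  rewrite lee_fin.
  have := ler_pM (ler0n R m) (sqrtr_ge0 (n%:R : R)) le_m le_sqrt.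
  by rewrite -mulrA ler_pdivrMl ?ltr0n //; lra.
have avg_ge : ((12%:R^-1 * Num.sqrt n%:R)%:E <= average_radio_use A (comb m) w R)%E.
  rewrite /average_radio_use lee_pdivlMl ?ltr0n; last by lia.
  by rewrite -EFinM mulrCA mulrA.
split; first by exists (comb m), w.
split.
  (* The same graph and wake-up times bound both suprema, as the average is at most the maximum. *)
  apply: (le_trans (le_trans avg_ge (average_le_max _ _ _ _ _))); first by lia.
  by apply: ereal_sup_ubound; exists (comb m), w.
by apply: (le_trans avg_ge); apply: ereal_sup_ubound; exists (comb m), w.
Qed.
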